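(* Let $n\geq 1$ and let $g:[0,\infty)\to\mathbb{R}$ be continuous with $g(0)=0$. Suppose $\mu$ is a finite signed Borel measure on $\mathbb{R}^n$ with $$0<\mu(\mathbb{R}^n)\leq|\mu|(\mathbb{R}^n)<\infty.$$ If $g$ has a positive and finite limit at infinity, $0<g(\infty)<\infty$, then there exists $x_c\in\mathbb{R}^n$ such that $V(x_c)=0$, where $$V(x)=\int_{\mathbb{R}^n} v(x+y)\,d\mu(y),\qquad x\in\mathbb{R}^n,$$ with $v(y)=g(|y|)\,y/|y|$ for $y\neq 0$ and $v(0)=0$.
   Context: $g(\infty)=\lim_{r\to\infty}g(r)$ denotes the limiting value of $g$ at infinity. $|\mu|=\mu^++\mu^-$ is the total variation measure of the signed measure $\mu$. *)

(* Defs.v *)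
From HB Require Import structures.
From mathcomp Require Import all_boot all_order all_algebra.
From mathcomp Require Import all_classical all_reals all_analysis.

Set Implicit Arguments.
Unset Strict Implicit.
Unset Printing Implicit Defensive.

Import Order.TTheory GRing.Theory Num.Theory.
Import numFieldNormedType.Exports.

Local Open Scope classical_set_scope.
Local Open Scope ring_scope.

(* R^n with its Borel sigma-algebra, generated by the open sets of the product
   topology, which is also the topology of the Euclidean norm. *)
Definition borelRn (R : realType) (n : nat) :=
  g_sigma_algebraType (@open 'rV[R]_n).

(* The library norm `|y| on 'rV[R]_n is the sup norm, so the Euclidean norm is
   defined separately. *)
Definition enorm (R : realType) (n : nat) (y : 'rV[R]_n) : R :=
  Num.sqrt (\sum_(i < n) y ord0 i ^+ 2).

Definition radial_field (R : realType) (n : nat) (g : R -> R) (y : 'rV[R]_n) :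
    'rV[R]_n :=
  if y == 0 then 0 else (g (enorm y) / enorm y) *: y.

Section signed_integral.
Context d (T : measurableType d) (R : realType).
Implicit Type nu : {charge set T -> \bar R}.

(* A Hahn decomposition fixed by choice. The Jordan parts, hence the total
   variation and the integral below, do not depend on it, as Hahn
   decompositions are unique up to null sets. *)
Definition hahn_pos nu : set T := projT1 (cid (Hahn_decomposition nu)).

Definition hahn_neg nu : set T :=
  projT1 (cid (projT2 (cid (Hahn_decomposition nu)))).

Lemma hahn_pos_neg nu : hahn_decomposition nu (hahn_pos nu) (hahn_neg nu).
Proof. exact: projT2 (cid (projT2 (cid (Hahn_decomposition nu)))). Qed.

Definition pos_variation nu : {finite_measure set T -> \bar R} :=
  jordan_pos (hahn_pos_neg nu).

Definition neg_variation nu : {finite_measure set T -> \bar R} :=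
  jordan_neg (hahn_pos_neg nu).

Definition tot_variation nu : {measure set T -> \bar R} :=
  charge_variation (hahn_pos_neg nu).

Definition charge_integral nu (f : T -> R) : R :=
  Rintegral (pos_variation nu) setT f - Rintegral (neg_variation nu) setT f.

End signed_integral.

(* The vector-valued integral is taken coordinatewise. *)
Definition potential_field (R : realType) (n : nat) (g : R -> R)
    (mu : {charge set (borelRn R n) -> \bar R}) (x : 'rV[R]_n) : 'rV[R]_n :=
  \row_(i < n) charge_integral mu
    (fun y : borelRn R n => radial_field g (x + (y : 'rV[R]_n)) ord0 i).

(* Main.v *)
Require Import Defs.
From HB Require Import structures.
From mathcomp Require Import all_boot all_order all_algebra.
From mathcomp Require Import zify ring lra.

(* For |x| large, v(x + y) is close to g(oo) x/|x|, so by dominated convergence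
   V(x) is close to g(oo) mu(R^n) x/|x|. Hence V_i(x) x_i > 0 on the faces
   |x_i| = r of a large cube [-r, r]^n, and a zero of V is the same thing as a
   fixed point of the bounded continuous map x |-> clip (x - V(x)), where clip
   truncates every coordinate to [-r, r].

   The fixed point comes from Scarf's combinatorial lemma, applied to the points
   with denominator k + 1 of a simplex, each coloured by a barycentric coordinate
   which the map does not decrease. The lemma gives a set of such points, of
   diameter O(1/k), whose colours are all the coordinates except some that are
   O(1/k) on the set; at a cluster point no barycentric coordinate decreases. *)

Set Implicit Arguments.
Unset Strict Implicit.
Unset Printing Implicit Defensive.

(** * Scarf's lemma *)

Section Scarf.
Variables (I X : finType) (r : I -> X -> nat).
Hypothesis r_inj : forall i, injective (r i).

(** Dominant sets play the part of the simplices of a triangulation, and rooms that of its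
    full-dimensional ones. *)
Definition dominant (A : {set X}) :=
  [forall y, exists i, forall x in A, r i y <= r i x].

Definition room (A : {set X}) := dominant A && (#|A| == #|I|).

Lemma dominantP (A : {set X}) :
  reflect (forall y, exists i, forall x, x \in A -> r i y <= r i x) (dominant A).
Proof.
apply: (iffP forallP) => h y.
  by have /existsP[i /forall_inP hi] := h y; exists i.
by apply/existsP; have [i hi] := h y; exists i; apply/forall_inP.
Qed.

Lemma dominantS (A B : {set X}) : A \subset B -> dominant B -> dominant A.
Proof.
move=> /subsetP sAB /dominantP dB; apply/dominantP => y.
by have [i hi] := dB y; exists i => x /sAB; exact: hi.
Qed.

(* Here [m i] is the [i]-least element of a dominant set [A] with one element less
   than [I]. As [m] maps onto [A], it takes one value twice, at [a] and [b], and is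
   injective otherwise. So a point completes [A] to a room iff it becomes the
   [k]-least element, for [k = a] or [k = b], and is the [k]-greatest element
   of [above k]. *)
Section Pivot.
Variables (A : {set X}) (m : I -> X) (a b : I).
Hypotheses (domA : dominant A) (cardA : #|A|.+1 = #|I|).
Hypotheses (mA : forall i, m i \in A).
Hypothesis (m_min : forall i x, x \in A -> r i (m i) <= r i x).
Hypotheses (neq_ab : a != b) (m_ab : m a = m b).

Definition above k := [set y | [forall i in predC1 k, r i (m i) < r i y]].
Definition top k := [set x in above k | [forall y in above k, r k y <= r k x]].

Lemma aboveP k y :
  reflect (forall i, i != k -> r i (m i) < r i y) (y \in above k).
Proof. by rewrite inE; exact: forall_inP. Qed.

Lemma topP k x : reflect (x \in above k /\ forall y, y \in above k -> r k y <= r k x)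
  (x \in top k).
Proof.
by rewrite /top in_set; apply: (iffP andP) => -[xk /forall_inP h].
Qed.

Lemma card_top k : #|top k| = (above k != set0).
Proof.
have [k0|[x0 x0k]] := set_0Vmem (above k).
  rewrite k0 eqxx; apply: eq_card0 => x.
  by apply/negP => /topP[]; rewrite k0 in_set0.
have -> : above k != set0 by apply/set0Pn; exists x0.
case: (@arg_maxnP _ x0 (mem (above k)) (r k) x0k) => x xk hx.
apply/eqP/cards1P; exists x; apply/setP => y; rewrite in_set1.
apply/topP/eqP => [[yk hy]|->]; last by split.
by apply: (@r_inj k); apply/eqP; rewrite eqn_leq hy// andbT; exact: hx.
Qed.

Lemma min_surj y : y \in A -> exists2 i, y = m i & forall x, x \in A -> r i y <= r i x.
Proof.
move=> yA; have /dominantP/(_ y)[i hi] := domA; exists i => //.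
by apply: (@r_inj i); apply/eqP; rewrite eqn_leq hi// m_min.
Qed.

Lemma above_notin k x : k \in [set a; b] -> x \in above k -> x \notin A.
Proof.
move=> kab /aboveP xk; apply/negP => /min_surj[i xi _].
have [ik|/xk] := eqVneq i k; last by rewrite xi ltnn.
(* The other index of the pair has the same minimum, and there [above k] demands a strict
   inequality. *)
have [k' kk' mk'] : exists2 k', k' != k & m k' = m k.
  move: kab; rewrite !inE => /orP[]/eqP->; first by exists b; rewrite 1?eq_sym.
  by exists a.
by have := xk _ kk'; rewrite xi ik mk' ltnn.
Qed.

Lemma room_pivot x : x \notin A ->
  room (x |: A) = (x \in top a :|: top b).
Proof.
move=> xA; have cxA : #|x |: A| = #|I| by rewrite cardsU1 xA add1n.
rewrite /room cxA eqxx andbT; apply/dominantP/idP => [dxA|].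
(* [M i] is the [i]-least element of [x |: A]. Dominance makes [M] onto, hence injective by
   cardinality. It agrees with [m] except at the one index [k] where it is [x], so [m a = m b]
   forces [k] to be [a] or [b]. *)
- pose M i := if r i x < r i (m i) then x else m i.
  have MA i : M i \in x |: A by rewrite /M; case: ifP; rewrite !inE ?eqxx// mA orbT.
  have M_min i y : y \in x |: A -> r i (M i) <= r i y.
    rewrite /M !inE => /orP[/eqP->|yA]; case: ltnP => //= h.
      by rewrite (leq_trans (ltnW h))// m_min.
    exact: m_min.
  have Msurj y : y \in x |: A -> exists i, y = M i.
    move=> yxA; have [i hi] := dxA y; exists i; apply: (@r_inj i).
    by apply/eqP; rewrite eqn_leq hi// M_min.
  have codM : M @: setT = x |: A.
    apply/setP => y; apply/imsetP/idP => [[i _ ->]//|/Msurj[i yi]]; by exists i.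
  have /imset_injP M_inj : #|M @: setT| == #|[set: I]| by rewrite codM cxA cardsT.
  have [k xk] : exists k, x = M k by apply: Msurj; rewrite setU11.
  have Mi i : i != k -> r i (m i) < r i x.
    move=> ik; rewrite ltn_neqAle; apply/andP; split.
      by apply: contraNneq xA => /r_inj <-.
    rewrite leqNgt; apply: contraNN ik => h; apply/eqP/M_inj => //.
    by rewrite -xk /M h.
  have Mm i : i != k -> M i = m i by move/Mi => mx; rewrite /M ltnNge (ltnW mx).
  have kt : x \in top k.
    apply/topP; split=> [|y /aboveP yk]; first exact/aboveP.
    have [i hi] := dxA y; have [<-|ik] := eqVneq i k; first by rewrite hi ?setU11.
    by have := yk _ ik; rewrite ltnNge hi// inE mA orbT.
  rewrite inE; have [->|ka] := eqVneq a k; first by rewrite kt.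
  have [->|kb] := eqVneq b k; first by rewrite kt orbT.
  by case/eqP: neq_ab; apply: M_inj => //; rewrite !Mm.
(* A point of [above k] is bounded in the order [k], by maximality of [x] and dominance of [A]; any
   other point fails to exceed [m i] for some [i != k]. *)
- have main k : k \in [set a; b] -> x \in top k ->
    forall y, exists i, forall z, z \in x |: A -> r i y <= r i z.
    move=> kab /topP[/aboveP xk hx] y; have [yk|] := boolP (y \in above k).
      exists k => z; rewrite !inE => /orP[/eqP->|zA]; first exact: hx.
      have /dominantP/(_ y)[i hi] := domA.
      have [<-|ik] := eqVneq i k; first exact: hi.
      by move/aboveP : yk => /(_ _ ik); rewrite ltnNge hi.
    rewrite inE negb_forall => /existsP[i]; rewrite negb_imply -leqNgt => /andP[ik yi].
    exists i => z; rewrite !inE => /orP[/eqP->|zA].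
      exact: leq_trans yi (ltnW (xk _ ik)).
    exact: leq_trans yi (m_min _ zA).
  by rewrite inE => /orP[]; apply: main; rewrite !inE eqxx ?orbT.
Qed.

Lemma card_rooms :
  #|[set B | room B & A \subset B]| = (above a != set0) + (above b != set0).
Proof.
have inab k x : k \in [set a; b] -> x \in top k -> x \notin A.
  by move=> kab /topP[xk _]; exact: above_notin xk.
have topA x : x \in top a :|: top b -> x \notin A.
  by rewrite inE => /orP[]; apply: inab; rewrite !inE eqxx ?orbT.
have -> : [set B | room B & A \subset B] = [set x |: A | x in top a :|: top b].
  apply/setP => B; rewrite inE; apply/andP/imsetP => [[rB sAB]|[x xt ->]].
    have : 0 < #|B :\: A|.
      rewrite cardsD (setIidPr sAB) subn_gt0; case/andP: rB => _ /eqP ->.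
      by rewrite -cardA.
    case/card_gt0P => x; rewrite inE => /andP[xA xB].
    have eB : x |: A = B.
      apply/eqP; rewrite eqEcard subUset sub1set xB sAB /= cardsU1 xA add1n cardA.
      by case/andP: rB => _ /eqP ->.
    by exists x => //; rewrite -room_pivot// eB.
  by rewrite room_pivot ?topA// subsetUr.
rewrite card_in_imset; last first.
  move=> x y /topA xA /topA yA /setP/(_ x); rewrite !inE eqxx (negbTE xA) !orbF.
  by move=> /esym/eqP.
rewrite cardsU -!card_top; suff -> : top a :&: top b = set0 by rewrite cards0 subn0.
(* As [a != b], a common point would exceed [m i] for every [i], against the dominance of [A]. *)
apply/setP => x; rewrite in_set0 in_setI; apply/negbTE/negP.
move=> /andP[/topP[/aboveP xa _] /topP[/aboveP xb _]].
have /dominantP/(_ x)[i hi] := domA.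
have [ia|/xa] := eqVneq i a; last by rewrite ltnNge hi.
by have := xb i; rewrite ia => /(_ neq_ab); rewrite -ia ltnNge hi.
Qed.

End Pivot.

Variables (s : I -> X) (c : X -> I) (x0 : X).
Hypothesis I_gt1 : 1 < #|I|.
Hypothesis slack_min : forall i x, r i (s i) <= r i x.
Hypothesis slack_max :
  forall i k x, i != k -> (forall j, x != s j) -> r i x < r i (s k).
Hypothesis x0_slack : forall j, x0 != s j.
Hypothesis c_slack : cancel s c.

Definition door i0 (A : {set X}) :=
  [&& dominant A, #|A|.+1 == #|I| & c @: A == ~: [set i0]].

(** If a door has a non-slack element [x], both sets [above] are inhabited, since [s k] exceeds [x]
    in every order but [k]. The all-slack door lies on the boundary: one of its two sets is
    empty. *)
Lemma odd_rooms i0 A : door i0 A ->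
  odd #|[set B | room B & A \subset B]| = (A == s @: ~: [set i0]).
Proof.
move=> /and3P[domA /eqP cardA /eqP cA].
have [x1 x1A] : exists x, x \in A.
  by apply/card_gt0P; rewrite -ltnS cardA.
pose m i := [arg min_(x < x1 in A) r i x].
have mA i : m i \in A by rewrite /m; case: arg_minnP.
have m_min i x : x \in A -> r i (m i) <= r i x.
  by move=> xA; rewrite /m; case: arg_minnP => // y yA; exact.
have [eA|neA] := eqVneq.
  have ms i : i != i0 -> m i = s i.
    move=> ii0; apply: (@r_inj i); apply/eqP; rewrite eqn_leq slack_min andbT m_min//.
    by rewrite eA imset_f// !inE.
  have : m i0 \in A by [].
  rewrite eA => /imsetP[j]; rewrite !inE => ji0 mi0.
  have i0j : i0 != j by rewrite eq_sym.
  rewrite -eA (@card_rooms A m i0 j)//; last by rewrite mi0 ms.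
  have -> : above m i0 != set0.
    apply/set0Pn; exists x0; apply/aboveP => i ii0; rewrite ms// ltn_neqAle.
    rewrite slack_min andbT; apply: contraNneq (x0_slack i) => /r_inj ->//.
  have -> : above m j = set0; last by rewrite eqxx.
  (* To exceed [m i0 = s j] in the order [i0], [y] must be slack and differ from [s j]; but any
     other [s l] is least in its own order [l]. *)
  apply/setP => y; rewrite in_set0; apply/negP => /aboveP yj.
  have := yj _ i0j; rewrite mi0.
  have [/existsP[l /eqP yl]|] := boolP [exists l, y == s l]; last first.
    rewrite negb_exists => /forallP ys.
    by rewrite ltnNge ltnW// slack_max.
  rewrite yl.  have [->|lj] := eqVneq l j; first by rewrite ltnn.
  have [->|li0] := eqVneq l i0; first by rewrite ltnNge slack_min.
  by have := yj _ lj; rewrite yl ms// ltnn.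
have [x xA xs] : exists2 x, x \in A & forall j, x != s j.
  have [/exists_inP[x xA /forallP xs]|] := boolP [exists x in A, [forall j, x != s j]].
    by exists x.
  (* Slack elements bear their own colour, so an all-slack door consists of the [s i] with
     [i != i0]. *)
  rewrite negb_exists_in => /forall_inP sA; case/negP: neA.
  rewrite eqEcard card_imset; last exact: can_inj c_slack.
  rewrite cardsC1 -cardA leqnn andbT; apply/subsetP => x xA.
  have := sA x xA; rewrite negb_forall => /existsP[j]; rewrite negbK => /eqP xj.
  by rewrite xj; apply: imset_f; rewrite -cA -(c_slack j) -xj imset_f.
have aboveN0 k : above m k != set0.
  apply/set0Pn; exists (s k); apply/aboveP => i ik.
  exact: leq_ltn_trans (m_min i x xA) (slack_max ik xs).
have /injectivePn[a [b neq_ab m_ab]] : ~~ injectiveb m.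
  apply/negP => /injectiveP inj_m; have h := card_imset [set: I] inj_m.
  have /subset_leq_card : m @: setT \subset A by apply/subsetP => _ /imsetP[i _ ->].
  by rewrite h cardsT -cardA ltnn.
by rewrite (card_rooms domA cardA mA m_min neq_ab m_ab) !aboveN0.
Qed.

(** Doors of [B] arise by deleting one element. If all colours occur, each occurs once and only the
    element coloured [i0] can go. Otherwise, an element [x] that can go shares its colour with
    exactly one other [x'], which can go instead. *)
Lemma odd_doors i0 B : room B ->
  odd #|[set A | door i0 A & A \subset B]| = (c @: B == setT).
Proof.
move=> /andP[domB /eqP cardB].
have doorsE : [set A | door i0 A & A \subset B] =
    [set B :\ x | x in [set x in B | c @: (B :\ x) == ~: [set i0]]].
  apply/setP => A; rewrite inE; apply/andP/imsetP => [[/and3P[_ /eqP cA ciA] AB]|].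
    have : 0 < #|B :\: A| by rewrite cardsD (setIidPr AB) cardB -cA subn_gt0.
    case/card_gt0P => x; rewrite inE => /andP[xA xB].
    have eA : A = B :\ x.
      apply/eqP; rewrite eqEcard subsetD1 AB xA /= -ltnS cA -cardB (cardsD1 x B).
      by rewrite xB.
    by exists x => //; rewrite inE xB -eA.
  move=> [x]; rewrite inE => /andP[xB cx] ->; rewrite /door cx subsetDl andbT.
  split=> //; apply/andP; split; first exact: dominantS (subsetDl _ _) domB.
  by rewrite -cardB (cardsD1 x B) xB.
rewrite doorsE card_in_imset => [|x y]; last first.
  rewrite !inE => /andP[xB _] /andP[yB _] /setP/(_ x).
  by rewrite !inE eqxx xB andbT; case: eqP.
have setTE x : x \in B -> c @: (B :\ x) = ~: [set i0] ->
    (c @: B == setT) = (c x == i0).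
  move=> xB cx; rewrite -(setD1K xB) imsetU1 cx.
  apply/eqP/eqP => [/setP/(_ i0)|->]; last by apply/setP => i; rewrite !inE orbN.
  by rewrite !inE eqxx orbF => /eqP.
have injD x : x \in B -> c @: (B :\ x) = ~: [set i0] -> {in B :\ x &, injective c}.
  move=> xB cx; apply/imset_injP; rewrite cx cardsC1 -cardB (cardsD1 x B) xB.
  by [].
have [cB|cB] := eqVneq.
  have /imset_injP c_inj : #|c @: B| == #|B| by rewrite cB cardsT cardB.
  have [x xB xi0] : exists2 x, x \in B & i0 = c x by apply/imsetP; rewrite cB inE.
  rewrite (_ : [set _ in _ | _] = [set x]) ?cards1//.
  apply/setP => y; rewrite !inE; apply/andP/eqP => [[yB /eqP cy]|->].
    have := setTE y yB cy; rewrite cB eqxx => /esym/eqP cyi.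
    by apply: c_inj => //; rewrite cyi.
  split=> //; apply/eqP/setP => i; rewrite !inE; apply/imsetP/idP => [[z]|ii0].
    by rewrite !inE => /andP[zx zB] ->; apply: contraNneq zx; rewrite xi0 => /c_inj ->.
  have [z zB zi] : exists2 z, z \in B & i = c z by apply/imsetP; rewrite cB inE.
  exists z => //; rewrite !inE zB andbT; apply: contraNneq ii0 => zx.
  by rewrite zi zx xi0.
have [->|[x]] := set_0Vmem [set x in B | c @: (B :\ x) == ~: [set i0]].
  by rewrite cards0.
rewrite inE => /andP[xB /eqP cx].
have cxi0 : c x != i0 by rewrite -(setTE x xB cx).
have [x' x'B cxx'] : exists2 x', x' \in B :\ x & c x = c x'.
  by apply/imsetP; rewrite cx !inE.
have xx' : x' != x by move: x'B; rewrite !inE => /andP[].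
have x'B' : x' \in B by move: x'B; rewrite !inE => /andP[].
rewrite (_ : [set _ in _ | _] = [set x; x']) ?cards2 1?eq_sym ?xx'//.
apply/setP => z; rewrite !inE; apply/andP/orP => [[zB /eqP cz]|].
  have [->|zx] := eqVneq z x; [by left|right].
  have [//|zx'] := eqVneq z x'.
  have /(_ x x') := injD z zB cz; rewrite !inE xB x'B' !(eq_sym _ z) zx zx'.
  by move=> /(_ isT isT cxx') /eqP; rewrite eq_sym (negbTE xx').
move=> [/eqP->|/eqP->]; first by rewrite xB cx.
split=> //; apply/eqP; rewrite -cx; apply/setP => i.
have swap u v : u \in B -> v \in B -> v != u -> c u = c v -> i \in c @: (B :\ u) ->
    i \in c @: (B :\ v).
  move=> uB vB vu cuv /imsetP[y]; rewrite !inE => /andP[yu yB] ->.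
  have [->|yv] := eqVneq y v.
    by rewrite -cuv imset_f// !inE uB eq_sym vu.
  by rewrite imset_f// !inE yv.
by apply/idP/idP; apply: swap => //; rewrite eq_sym.
Qed.

(* Count the inclusions of a door in a room: a door lies in two rooms, except the one
   made of slack elements, which lies in one, and a room contains zero or two doors,
   unless it bears all the colours. *)
Lemma scarf : exists A, [/\ dominant A, #|A| = #|I| & c @: A = setT].
Proof.
have [i0 _] : exists i0 : I, i0 \in I by apply/card_gt0P; exact: ltnW.
pose inc A B : bool := [&& door i0 A, room B & A \subset B].
have dc : \sum_A \sum_B inc A B = \sum_B \sum_A inc A B by exact: exchange_big.
have sumE (P : pred {set X}) : \sum_A P A = #|[set A | P A]|.
  rewrite cardsE -sum1_card [RHS]big_mkcond; apply: eq_bigr => A _.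
  by rewrite unfold_in; case: (P A).
have oddL : odd (\sum_A \sum_B inc A B).
  have -> : \sum_A \sum_B inc A B =
      \sum_(A | door i0 A) #|[set B | room B & A \subset B]|.
    rewrite [RHS]big_mkcond; apply: eq_bigr => A _; rewrite /inc -sumE.
    by case: (door i0 A) => //; rewrite big1.
  have dA0 : door i0 (s @: ~: [set i0]).
    have s_inj := can_inj c_slack.
    apply/and3P; split.
    - apply/dominantP => y; have [->|ys] := eqVneq y (s i0).
        by exists i0 => x _; exact: slack_min.
      have [/existsP[l /eqP yl]|] := boolP [exists l, y == s l].
        by exists l => x _; rewrite yl slack_min.
      rewrite negb_exists => /forallP ys'; exists i0 => x /imsetP[i].
      by rewrite !inE => ii0 ->; rewrite ltnW// slack_max// eq_sym.
    - by rewrite card_imset// cardsC1 prednK// ltnW.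
    - by rewrite -imset_comp (eq_imset (g := id)) ?imset_id.
  rewrite (bigD1 _ dA0) /= oddD (@odd_rooms i0)// eqxx.
  rewrite (big_morph odd oddD (erefl : odd 0 = false)) big1// => A /andP[dA An].
  by rewrite (@odd_rooms i0)// (negbTE An).
have [/existsP[B /and3P[dB /eqP cB /eqP ciB]]|] :=
  boolP [exists B, [&& dominant B, #|B| == #|I| & c @: B == setT]].
  by exists B.
rewrite negb_exists => /forallP noB; case/negP: oddL; rewrite dc.
rewrite (big_morph odd oddD (erefl : odd 0 = false)).
rewrite big1// => B _; rewrite sumE.
have [rB|/negbTE rB] := boolP (room B); last first.
  by rewrite (eq_card0 (A := [set _ | _]))// => A; rewrite inE /inc rB andbF.
rewrite (_ : [set _ | _] = [set A | door i0 A & A \subset B]); last first.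
  by apply/setP => A; rewrite !inE /inc rB.
rewrite odd_doors//; have := noB B; rewrite andbA.
by move: (rB); rewrite /room => -> /= /negbTE.
Qed.

End Scarf.

(** * Scarf's lemma on the lattice points of a simplex *)

Section Grid.
Variables (n N : nat).
Hypothesis n_gt0 : 0 < n.
Let G := {ffun 'I_n.+1 -> 'I_N.+1}.
Let T := {x : G | \sum_i (x i : nat) == N}.
Let X := (T + 'I_n.+1)%type.

(* The lattice points are compared by their [i]-th coordinate, ties being broken
   by an enumeration; the slack element [inr k] lies above all of them, except
   for the order [k], of which it is the least element. *)
Let rank (i : 'I_n.+1) (u : X) : nat :=
  match u with
  | inl x => (val x i * #|{: T}| + enum_rank x).+1
  | inr k => if k == i then 0 else (N.+1 * #|{: T}|).+1 + k
  end.

Let rank_inl i x : 0 < rank i (inl x) <= N.+1 * #|{: T}|.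
Proof.
rewrite /rank ltnS leq0n /= mulSnr -addnS leq_add//.
by rewrite leq_mul2r -ltnS ltn_ord orbT.
Qed.

Let rank_inj i : injective (rank i).
Proof.
move=> [x|k] [y|l].
- move=> /= [] h; congr inl; apply: enum_rank_inj; apply/val_inj.
  have := congr1 (modn^~ #|{: T}|) h; rewrite !modnMDl !modn_small//; exact: ltn_ord.
- have := rank_inl i x; move: (rank i (inl x)) => m /=.
  case: ifP => _ h1 h2; lia.
- have := rank_inl i y; move: (rank i (inl y)) => m /=.
  case: ifP => _ h1 h2; lia.
- rewrite /=; case: eqP => [->|_]; case: eqP => [->|_] h //; try by rewrite addSn in h.
  by congr inr; apply/val_inj => /=; lia.
Qed.

Let rank_le i x y : rank i (inl x) <= rank i (inl y) -> val x i <= val y i.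
Proof.
have lex a b K p q : p < K -> q < K -> a * K + p <= b * K + q -> a <= b.
  move=> pK qK h; rewrite leqNgt; apply/negP => ba.
  have : b.+1 * K <= a * K by rewrite leq_mul2r ba orbT.
  rewrite mulSn; lia.
by rewrite /= ltnS; apply: lex; exact: ltn_ord.
Qed.

(** By dominance no lattice point exceeds the coordinatewise minimum [m] at every index of [C],
    which forces [N <= \sum_i m i + n]. The lattice points of [A] lie above [m] and have sum [N], so
    each coordinate exceeds that of [m] by at most [n]. If a colour comes from a slack element, then
    [m i = 0] and [x i <= n]. *)
Lemma scarf_grid (c : G -> 'I_n.+1) :
  exists2 x : G, \sum_i (x i : nat) = N &
    forall i, x i <= n \/ exists z : G,
      [/\ \sum_i (z i : nat) = N, c z = i & forall j, z j <= x j + n /\ x j <= z j + n].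
Proof.
pose s (k : 'I_n.+1) : X := inr k.
pose col (u : X) := match u with inl x => c (val x) | inr k => k end.
pose v0 : G := [ffun i => if i == ord0 then ord_max else ord0].
have v0P : \sum_i (v0 i : nat) == N.
  rewrite (bigD1 ord0) //= ffunE eqxx big1 ?addn0// => i i0.
  by rewrite ffunE (negbTE i0).
have slack_min i u : rank i (s i) <= rank i u by rewrite /= eqxx.
have slack_max i k u : i != k -> (forall j, u != s j) -> rank i u < rank i (s k).
  case: u => [x ik _|l _ /(_ l)]; last by rewrite eqxx.
  have /andP[_] := rank_inl i x; move: (rank i (inl x)) => p.
  by rewrite /= eq_sym (negbTE ik) addSn ltnS => /leq_trans -> //; exact: leq_addr.
have [||//|A [/dominantP domA _ cA]] :=
  @scarf _ _ rank rank_inj s col (inl (Sub v0 v0P)) _ slack_min slack_max _ _.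
  by rewrite card_ord ltnS.
  by [].
pose C := [set i | s i \notin A].
have domT (y : T) : exists2 i, i \in C & forall x : T, inl x \in A -> val y i <= val x i.
  have [i hi] := domA (inl y); exists i.
    rewrite inE; apply/negP => /hi; rewrite leqNgt; have := rank_inl i y.
    by rewrite /rank /s eqxx => /andP[->].
  by move=> x /hi /rank_le.
(* Dominance makes [C] nonempty, and a colour in [C] is not borne by a slack element of [A]. *)
have [x xA] : exists x : T, inl x \in A.
  have [i iC _] := domT (Sub v0 v0P).
  have : i \in col @: A by rewrite cA inE.
  move=> /imsetP[[x xA _|k kA ki]]; first by exists x.
  by move: iC; rewrite inE ki kA.
pose m i := if i \in C then val [arg min_(y < x | inl y \in A) val y i] i : nat else 0.
have m_min i (y : T) : inl y \in A -> m i <= val y i.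
  by move=> yA; rewrite /m; case: ifP => // _; case: arg_minnP => // z _; exact.
have domm (y : T) : exists2 i, i \in C & val y i <= m i.
  have [i iC hi] := domT y; exists i => //; rewrite /m iC.
  by case: arg_minnP => // z /hi.
have sm : N <= \sum_i m i + n.
  have [i0 i0C _] := domT x.
  rewrite leqNgt; apply/negP => lt_mN.
  have leC : \sum_i (m i + (i \in C)) <= N.
    rewrite big_split /= (leq_trans _ lt_mN)// -addnS leq_add2l.
    rewrite -[leqRHS](card_ord n.+1) -sum1_card; apply: leq_sum => i _.
    exact: leq_b1.
  (* Adding 1 to [m] on [C] keeps the sum at most [N]; giving the surplus [d] to the coordinate [i0]
     yields a lattice point that dominance forbids. *)
  pose d := N - \sum_i (m i + (i \in C)).
  pose w i := m i + (i \in C) + (if i == i0 then d else 0).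
  have sw : \sum_i w i = N.
    rewrite big_split /= [X in _ + X](bigD1 i0)//= eqxx [X in d + X]big1 ?addn0.
      by rewrite subnKC.
    by move=> i /negbTE ->.
  have wN i : w i < N.+1 by rewrite ltnS -sw (bigD1 i)//= leq_addr.
  pose y : G := [ffun i => Ordinal (wN i)].
  have yP : \sum_i (y i : nat) == N.
    by rewrite -[X in _ == X]sw; apply/eqP/eq_bigr => i _; rewrite ffunE.
  have [i iC] := domm (Sub y yP); rewrite /= ffunE /= /w iC; lia.
have le_mn (y : T) i : inl y \in A -> val y i <= m i + n.
  move=> yA; have /eqP := valP y; rewrite (bigD1 i)//= => sy.
  have := leq_trans (eq_leq sy) sm.
  rewrite [X in _ <= X + _](bigD1 i)//= addnAC => h.
  rewrite -(leq_add2r (\sum_(j | j != i) val y j)); apply: leq_trans h _.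
  by rewrite leq_add2l; apply: leq_sum => j _; exact: m_min.
exists (val x); first exact/eqP/(valP x).
move=> i; have : i \in col @: A by rewrite cA inE.
move=> /imsetP[[z zA iz|k kA ki]]; [right|left].
  exists (val z); split=> //; first exact/eqP/(valP z).
  by move=> j; split; [apply: leq_trans (le_mn _ _ zA) _|apply: leq_trans (le_mn _ _ xA) _];
    rewrite leq_add2r m_min.
have := le_mn _ i xA; rewrite /m inE ki /= kA; exact.
Qed.

End Grid.

(** * Fixed points of bounded continuous maps *)

From mathcomp Require Import all_classical all_reals all_analysis.
From mathcomp Require Import measurable_realfun.

Import Order.TTheory GRing.Theory Num.Theory.
Import numFieldNormedType.Exports.

Local Open Scope classical_set_scope.
Local Open Scope ring_scope.

Lemma continuous_sum (R : numFieldType) (T : topologicalType) (I : finType)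
    (f : I -> T -> R) :
  (forall i, continuous (f i)) -> continuous (fun x => \sum_i f i x).
Proof.
move=> cf x; apply: cvg_big => [|i _]; last exact: cf.
exact: add_continuous.
Qed.

Lemma continuous_coord (R : realType) n (j : 'I_n) :
  continuous (fun x : 'rV[R]_n => x ord0 j).
Proof. by have := @coord_continuous R 1 n ord0 j; apply. Qed.

Lemma widen_lift_max n (i : 'I_n) : widen_ord (leqnSn n) i = lift ord_max i.
Proof. by apply/val_inj; rewrite /= /bump leqNgt ltn_ord. Qed.

Section FixedPoint.
Variables (R : realType) (n : nat).
Hypothesis n_gt0 : (0 < n)%N.
Variables (f : 'I_n -> 'rV[R]_n -> R) (L : R).
Hypothesis L_gt0 : 0 < L.
Hypothesis f_cont : forall j, continuous (f j).
Hypothesis f_bound : forall j x, `|f j x| <= L.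

(* Up to a factor, [height i] is the [i]-th barycentric coordinate in the simplex
   cut out by [x_j >= - L] and [\sum_j x_j <= n L], and [drift i] is its increment
   from [x] to [f x]. *)
Let height (i : 'I_n.+1) (x : 'rV[R]_n) : R :=
  if unlift ord_max i is Some j then x ord0 j + L else n%:R * L - \sum_j x ord0 j.

Let drift (i : 'I_n.+1) (x : 'rV[R]_n) : R :=
  if unlift ord_max i is Some j then f j x - x ord0 j
  else \sum_j (x ord0 j - f j x).

Let height_cont i : continuous (height i).
Proof.
rewrite /height; case: unliftP => [j _|_] x.
  exact: (cvgD (@continuous_coord _ _ j x) (cvg_cst _)).
exact: (cvgB (cvg_cst _) (@continuous_sum _ _ _ (fun j (x : 'rV[R]_n) => x ord0 j)
  (@continuous_coord R n) x)).
Qed.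

Let drift_cont i : continuous (drift i).
Proof.
rewrite /drift; case: unliftP => [j _|_] x.
  exact: (cvgB (@f_cont j x) (@continuous_coord _ _ j x)).
apply: (@continuous_sum _ _ _ (fun j (x : 'rV[R]_n) => x ord0 j - f j x)) => j y.
exact: (cvgB (@continuous_coord _ _ j y) (@f_cont j y)).
Qed.

Let sum_drift x : \sum_i drift i x = 0.
Proof.
rewrite big_ord_recr /= /drift unlift_none; under eq_bigr do rewrite widen_lift_max liftK.
by rewrite -big_split big1 //= => i _; rewrite addrA subrK subrr.
Qed.

(** The increments sum to zero, so they cannot all be negative. *)
Let color x : {i | 0 <= drift i x}.
Proof.
apply/cid; apply: contrapT => /forallNP h.
have h' i : drift i x < 0 by rewrite ltNge; apply/negP.
have /eqP : \sum_i - drift i x = 0 by rewrite sumrN sum_drift oppr0.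
rewrite psumr_eq0 => [|i _]; last by rewrite oppr_ge0 ltW.
move=> /allP/(_ ord0); rewrite mem_index_enum oppr_eq0 => /(_ isT).
by rewrite lt_eqF.
Qed.

(** This is the sum of all the heights of any point. *)
Let M : R := 2 * n%:R * L.

Let M_ge0 : 0 <= M.
Proof. by rewrite /M mulr_ge0 ?mulr_ge0// ltW. Qed.

(** The grid with [N = k + 1] has steps of length [M / (k + 1)], so a discrepancy of [n] steps
    becomes [M n / (k + 1)]. The box serves to extract a cluster point. *)
Let approx (k : nat) : exists x : 'rV[R]_n,
  (forall j, x ord0 j \in `[- L, M - L]) /\
  forall i, height i x <= M * n%:R / k.+1%:R \/ exists y,
    0 <= drift i y /\ forall j, `|x ord0 j - y ord0 j| <= M * n%:R / k.+1%:R.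
Proof.
pose q := M / k.+1%:R.
have q_ge0 : 0 <= q by rewrite divr_ge0.
pose pt (z : {ffun 'I_n.+1 -> 'I_k.+2}) : 'rV[R]_n :=
  \row_j (q * (z (lift ord_max j))%:R - L).
have qk : q * k.+1%:R = M by rewrite divfK// pnatr_eq0.
have [x sx hx] := scarf_grid n_gt0 (fun z => projT1 (color (pt z))).
have height_pt i : height i (pt x) = q * (x i)%:R.
  rewrite /height; case: unliftP => [j ->|->]; first by rewrite mxE subrK.
  under eq_bigr do rewrite mxE.
  rewrite sumrB -mulr_sumr -natr_sum sumr_const card_ord.
  have := sx; rewrite big_ord_recr /=; set s := (\sum_(_ < _) _)%N => sx'.
  rewrite (_ : (\sum_i _)%N = s); last first.
    by apply: eq_bigr => j _; rewrite widen_lift_max.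
  have /(congr1 (fun m : nat => q * m%:R)) := sx'.
  rewrite natrD mulrDr qk /M -mulr_natl => qs.
  by lra.
have le_q (a b : nat) : (a <= b + n)%N -> q * a%:R <= q * b%:R + M * n%:R / k.+1%:R.
  have -> : M * n%:R / k.+1%:R = q * n%:R by rewrite /q mulrAC.
  by move=> ab; rewrite -mulrDr -natrD ler_wpM2l// ler_nat.
exists (pt x); split=> [j|i].
  rewrite mxE in_itv /= lerD2r -qk ler_wpM2l ?ler_nat ?leq_ord// andbT.
  by rewrite lerDr mulr_ge0.
have [xin|[z [_ zi xz]]] := hx i; [left|right].
  by have := le_q _ 0 xin; rewrite height_pt mulr0 add0r.
exists (pt z); split; first by have := projT2 (color (pt z)); rewrite zi.
move=> j; rewrite !mxE; have [/le_q + /le_q] := xz (lift ord_max j).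
move: (q * _) (q * _) (M * _ / _) => u v w uv vu.
by rewrite ler_norml; apply/andP; split; lra.
Qed.

Lemma bounded_fixed_point : exists x, forall j, f j x = x ord0 j.
Proof.
have [x_ x_P] := choice approx.
have Kcpt : compact [set v : 'rV[R]_n | forall j, v ord0 j \in `[- L, M - L]].
  by apply: (@rV_compact _ _ (fun=> `[- L, M - L]%classic)) => _; exact: segment_compact.
have [|p [pK clp]] := Kcpt (x_ @ \oo) _.
  by exists 0%N => // k _ j /=; exact: (x_P k).1.
(* Otherwise the height stays above half its value and the drift negative on a ball around [p]. For
   a large [k] with [x_ k] close to [p], either the height of [x_ k] is too small or a point [y] of
   the ball has nonnegative drift. *)
have hp i : height i p <= 0 \/ 0 <= drift i p.
  have [|hi] := leP (height i p) 0; first by left.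
  right; rewrite leNgt; apply/negP => di.
  have /nbhs_ballP[e /= e0 pe] : \forall y \near p,
      height i p / 2 < height i y /\ drift i y < 0.
    near=> y; split; near: y.
      by apply: cvgr_gt; [exact: height_cont|lra].
    by apply: cvgr_lt di; exact: drift_cont.
  pose d := Num.min (e / 2) (height i p / 2).
  have d0 : 0 < d by rewrite lt_min; apply/andP; split; lra.
  have [k0 _ hk0] : \forall k \near \oo, M * n%:R / k.+1%:R < d.
    have Mn_gt0 : 0 < M * n%:R + 1 by rewrite ltr_wpDl// mulr_ge0.
    have d'0 : 0 < d / (M * n%:R + 1) by exact: divr_gt0.
    near=> k; have ltk : k.+1%:R^-1 < d / (M * n%:R + 1).
      by near: k; exact: (near_infty_natSinv_lt (PosNum d'0)).
    rewrite ltr_pdivlMr// in ltk.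
    apply: le_lt_trans ltk; rewrite mulrC ler_wpM2l ?lerDl//.
  have [||y0 [[k /= k0k <-] pxk]] :=
    clp [set x_ k | k in [set k | (k0 <= k)%N]] (ball p (e / 2)).
  - by exists k0 => // k k0k; exists k.
  - by apply: nbhsx_ballx; lra.
  have xp : ball p e (x_ k) by apply: le_ball pxk; lra.
  have [hxk dxk] := pe _ xp.
  have kd := hk0 _ k0k.
  have [h|[y [dy xy]]] := (x_P k).2 i.
    have := le_lt_trans h (hk0 _ k0k); rewrite lt_min => /andP[_]; lra.
  have py : ball p e y.
    rewrite (splitr e); apply: (ball_triangle pxk); split; first lra.
    move=> a b; rewrite ord1 /ball /=; apply: le_lt_trans (xy b) _.
    by apply: lt_le_trans kd _; rewrite ge_min lexx.
  by have [_] := pe _ py; rewrite ltNge dy.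
have fL j : - L <= f j p <= L by rewrite -ler_norml.
(* Where the height is at most 0, the bound [L] on [f] keeps the drift nonnegative. *)
have dp i : 0 <= drift i p.
  have [|//] := hp i; rewrite /height /drift; case: unliftP => [j _|_].
    by have := fL j; lra.
  rewrite subr_le0 => h; rewrite sumrB subr_ge0 (le_trans _ h)//.
  rewrite -[X in X%:R](card_ord n) mulr_natl -sumr_const.
  by apply: ler_sum => j _; have /andP[] := fL j.
exists p => j; apply/eqP; rewrite -subr_eq0.
(* Nonnegative increments with sum zero all vanish. *)
have /eqP := sum_drift p; rewrite psumr_eq0 => [/allP/(_ (lift ord_max j))|i _//].
by rewrite mem_index_enum /drift liftK => /(_ isT).
Unshelve. all: by end_near. Qed.

End FixedPoint.

(** * The radial field *)

Section EuclideanNorm.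
Variables (R : realType) (n : nat).
Implicit Types x y : 'rV[R]_n.

Lemma enorm_ge0 x : 0 <= enorm x.
Proof. exact: sqrtr_ge0. Qed.

Lemma enorm_sqr x : enorm x ^+ 2 = \sum_i x ord0 i ^+ 2.
Proof. by rewrite sqr_sqrtr// sumr_ge0// => i _; exact: sqr_ge0. Qed.

Lemma coord_le_enorm x i : `|x ord0 i| <= enorm x.
Proof.
rewrite -(@ler_pXn2r _ 2)// ?nnegrE ?enorm_ge0// enorm_sqr real_normK ?num_real//.
by rewrite (bigD1 i)//= lerDl sumr_ge0// => j _; exact: sqr_ge0.
Qed.

Lemma enorm0 : enorm (0 : 'rV[R]_n) = 0.
Proof. by rewrite /enorm big1 ?sqrtr0// => i _; rewrite mxE expr0n. Qed.

Lemma enorm_eq0 x : (enorm x == 0) = (x == 0).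
Proof.
apply/eqP/eqP => [x0|->]; last exact: enorm0.
apply/rowP => i; rewrite mxE; apply/eqP; rewrite -normr_eq0.
by rewrite eq_le normr_ge0 -{1}x0 coord_le_enorm.
Qed.

(* Factor [|x|^2 - |y|^2] termwise and divide by [|x| + |y|]. *)
Lemma enorm_lipschitz x y :
  `|enorm x - enorm y| <= \sum_i `|x ord0 i - y ord0 i|.
Proof.
have [s0|s0] := eqVneq (enorm x + enorm y) 0.
  have := enorm_ge0 x; have := enorm_ge0 y => y0 x0.
  have -> : enorm x - enorm y = 0 by lra.
  by rewrite normr0 sumr_ge0.
have s_gt0 : 0 < enorm x + enorm y.
  by rewrite lt_neqAle eq_sym s0 addr_ge0 ?enorm_ge0.
rewrite -(ler_pM2r s_gt0) -{1}(gtr0_norm s_gt0) -normrM -subr_sqr !enorm_sqr -sumrB.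
rewrite mulr_suml; apply: le_trans (ler_norm_sum _ _ _) _; apply: ler_sum => i _.
rewrite subr_sqr normrM ler_wpM2l// (le_trans (ler_normD _ _))//.
by rewrite lerD ?coord_le_enorm.
Qed.

Lemma enorm_continuous : continuous (@enorm R n).
Proof.
move=> x; apply/(@cvgrPdist_le _ _ _ (nbhs _)) => e e0.
have cv : continuous (fun y : 'rV[R]_n => \sum_i `|x ord0 i - y ord0 i|).
  apply: (@continuous_sum _ _ _ (fun i (y : 'rV[R]_n) => `|x ord0 i - y ord0 i|)) => i y.
  exact: (cvg_norm (cvgB (cvg_cst _) (@continuous_coord _ _ i y))).
have cx := cv x; rewrite /continuous_at big1 in cx; last first.
  by move=> i _; rewrite subrr normr0.
near=> y; rewrite (le_trans (enorm_lipschitz _ _))// ltW//; near: y.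
exact: (cvgr_lt 0 cx).
Unshelve. all: by end_near. Qed.

End EuclideanNorm.

Section BoundedHalfLine.
Variables (R : realType) (g : R -> R) (l : R).
Hypothesis g_cont : {within `[0, +oo[, continuous g}.
Hypothesis g_lim : g r @[r --> +oo] --> l.

(** Near infinity [g] stays within 1 of [l], and the remaining segment is compact. *)
Lemma half_line_bounded : exists2 B, 0 < B & forall r, 0 <= r -> `|g r| <= B.
Proof.
have [K [_ hK]] : \forall r \near +oo, `|l - g r| <= 1 by exact: cvgr_dist_le.
pose K' := `|K| + 1.
have K'0 : 0 <= K' by rewrite /K' addr_ge0.
have gK' : {within `[0, K'], continuous (Num.norm \o g)}.
  have gK : {within `[0, K'], continuous g}.
    apply: continuous_subspaceW g_cont => x /=.
    by rewrite !in_itv /= andbT => /andP[].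
  by move=> x; exact: (cvg_norm (gK x)).
have [c _ hc] := EVT_max K'0 gK'.
exists (`|g c| + `|l| + 1); first by rewrite ltr_pwDr// addr_ge0.
move=> r r0; have [rK|Kr] := leP r K'.
  have := hc r; rewrite in_itv /= r0 rK => /(_ isT) /le_trans; apply.
  by rewrite -addrA lerDl addr_ge0.
have Kr' : K < r by apply: le_lt_trans Kr; rewrite (le_trans (ler_norm K))// lerDl.
have := hK r Kr'; rewrite distrC => h.
rewrite -[g r](subrK l) (le_trans (ler_normD _ _))//.
by have := normr_ge0 (g c); lra.
Qed.

End BoundedHalfLine.

Section RadialField.
Variables (R : realType) (n : nat) (g : R -> R).
Hypothesis g_cont : {within `[0, +oo[, continuous g}.
Hypothesis g0 : g 0 = 0.
Implicit Types x y : 'rV[R]_n.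

Lemma radial_fieldE y i : radial_field g y ord0 i = g (enorm y) / enorm y * y ord0 i.
Proof. by rewrite /radial_field; case: eqP => [->|_]; rewrite mxE ?mulr0. Qed.

Lemma radial_field_le y i : `|radial_field g y ord0 i| <= `|g (enorm y)|.
Proof.
rewrite radial_fieldE -mulrA normrM ler_piMr// normrM normfV.
have [->|y0] := eqVneq (enorm y) 0; first by rewrite normr0 invr0 mul0r.
rewrite (ger0_norm (enorm_ge0 y)) mulrC ler_pdivrMr ?mul1r ?coord_le_enorm//.
by rewrite lt_neqAle eq_sym y0 enorm_ge0.
Qed.

Lemma radial_profile_continuous : continuous (fun y : 'rV[R]_n => g (enorm y)).
Proof.
move=> y A gA.
have y_in : `[0, +oo[%classic (enorm y) by rewrite /= in_itv /= andbT enorm_ge0.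
have /subspace_continuousP/(_ _ y_in A gA) hA := g_cont.
apply: (@filterS _ (nbhs y) _ _ _ _ (@enorm_continuous R n y _ hA)) => z.
by apply; rewrite /= in_itv /= andbT enorm_ge0.
Qed.

(** At the origin the field is dominated by [g (enorm y)], which tends to [g 0 = 0]; elsewhere the
    norm in the denominator is nonzero. *)
Lemma radial_field_continuous i : continuous (fun y => radial_field g y ord0 i).
Proof.
move=> y; have [->|y0] := eqVneq y 0.
  apply/(@cvgrPdist_le _ _ _ (nbhs _)) => e e0.
  have h0 : g (enorm z) @[z --> (0 : 'rV[R]_n)] --> g (enorm (0 : 'rV[R]_n)).
    exact: radial_profile_continuous.
  have := @cvgr_dist_le _ _ _ (nbhs (0 : 'rV[R]_n)) _ _ _ h0 e e0; rewrite enorm0 g0.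
  move=> g_small; near=> z; rewrite {1}/radial_field eqxx mxE sub0r normrN.
  rewrite (le_trans (radial_field_le _ _))// -normrN -sub0r; near: z.
  exact: g_small.
rewrite (_ : (fun y => _) = fun y => g (enorm y) / enorm y * y ord0 i); last first.
  by apply/funext => z; rewrite radial_fieldE.
rewrite /continuous_at; apply: (cvgM _ (@continuous_coord _ _ i y)).
apply: (cvgM (@radial_profile_continuous y)).
by apply: cvgV; [rewrite enorm_eq0|exact: enorm_continuous].
Unshelve. all: by end_near. Qed.

End RadialField.

(** This lets dominated convergence, a statement on sequences, give continuity of the potential. *)
Lemma sequential_continuity (R : realType) n (f : 'rV[R]_n -> R) :
  (forall x (u : nat -> 'rV[R]_n), u k @[k --> \oo] --> x -> f (u k) @[k --> \oo] --> f x) ->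
  continuous f.
Proof.
move=> h x; apply/(@cvgrPdist_le _ _ _ (nbhs _)) => e e0; apply: contrapT => nh.
have /choice[u hu] (k : nat) : exists v, ball x k.+1%:R^-1 v /\ e < `|f x - f v|.
  apply: contrapT => /forallNP hk; apply: nh.
  apply/nbhs_ballP; exists k.+1%:R^-1 => [|y xy]; first by rewrite /= invr_gt0.
  by rewrite /= leNgt; apply/negP => hy; apply: (hk y).
have ux : u k @[k --> \oo] --> x.
  apply/cvg_ballP => d d0; near=> k.
  apply: le_ball (hu k).1; apply/ltW; near: k.
  exact: (near_infty_natSinv_lt (PosNum d0)).
have := h _ _ ux => /cvgr_dist_le/(_ _ e0)[k0 _ /(_ k0 (leqnn _))] /=.
by rewrite leNgt (hu k0).2.
Unshelve. all: by end_near. Qed.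

(** * Bounded convergence for finite Borel measures *)

Section ChargeIntegral.
Variables (R : realType) (n : nat).
Local Notation T := (borelRn R n).

Lemma continuous_borel (f : 'rV[R]_n -> R) :
  continuous f -> measurable_fun [set: T] (f : T -> R).
Proof.
move=> /continuousP cf; apply: (measurability _ (RGenOpens.measurableE R)).
move=> _ [_ [a [b ->] <-]]; rewrite setTI; apply: sub_sigma_algebra.
exact/cf/interval_open.
Qed.

Lemma bounded_integrable (nu : {finite_measure set T -> \bar R}) (f : T -> R) B :
  measurable_fun setT f -> (forall y, `|f y| <= B) -> nu.-integrable setT (EFin \o f).
Proof.
move=> mf fB; apply: measurable_bounded_integrable => //.
  by rewrite ltey_eq fin_num_measure.
exists B; split; first exact: num_real.
by move=> M BM y _ /=; rewrite (le_trans (fB y))// ltW.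
Qed.

Lemma Rintegral_bounded_cvg (nu : {finite_measure set T -> \bar R})
    (f_ : nat -> T -> R) (f : T -> R) B :
  (forall k, measurable_fun setT (f_ k)) -> (forall k y, `|f_ k y| <= B) ->
  (forall y, f_ k y @[k --> \oo] --> f y) ->
  Rintegral nu setT (f_ k) @[k --> \oo] --> Rintegral nu setT f.
Proof.
move=> mf_ f_B f_f; pose F k := EFin \o f_ k.
have mF k : measurable_fun setT (F k) by exact/measurable_EFinP.
have F_f y : setT y -> F ^~ y @ \oo --> (EFin \o f) y.
  by move=> _; apply: cvg_EFin; [exact: nearW|exact: f_f].
have iB : nu.-integrable setT (EFin \o cst B) by exact: finite_measure_integrable_cst.
have F_B k y : setT y -> (`|F k y| <= (EFin \o cst B) y)%E by move=> _; rewrite lee_fin.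
have int_f : nu.-integrable setT (EFin \o f).
  exact: (lebesgue_integral_dominated_convergence.dominated_integrable
    measurableT F _ _ mF F_f iB F_B).
apply: fine_cvg; rewrite fineK; last exact: (integrable_fin_num _ int_f).
exact: (dominated_cvg measurableT mF F_f _ iB F_B).
Qed.

End ChargeIntegral.

Lemma unit_vector_dist (R : realType) n (x y : 'rV[R]_n) i :
  0 < enorm x -> 0 < enorm (x + y) ->
  `|(x + y) ord0 i / enorm (x + y) - x ord0 i / enorm x| <=
    2 * (\sum_j `|y ord0 j|) / enorm (x + y).
Proof.
move=> x0 xy0; set S := \sum_j _.
have yS : `|y ord0 i| <= S by rewrite /S (bigD1 i)//= lerDl sumr_ge0.
have dS : `|enorm x - enorm (x + y)| <= S.
  rewrite (le_trans (enorm_lipschitz _ _))// le_eqVlt; apply/orP; left; apply/eqP.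
  by apply: eq_bigr => j _; rewrite mxE opprD addNKr normrN.
(* Each of the two terms of the new numerator is at most [S], whence the factor 2. *)
have -> : (x + y) ord0 i / enorm (x + y) - x ord0 i / enorm x =
    (y ord0 i + x ord0 i / enorm x * (enorm x - enorm (x + y))) / enorm (x + y).
  by rewrite mxE; field; rewrite !gt_eqF.
rewrite normrM normfV (gtr0_norm xy0) ler_wpM2r ?invr_ge0 ?enorm_ge0//.
rewrite (le_trans (ler_normD _ _))// mulr_natl mulr2n lerD// normrM.
apply: le_trans dS; rewrite ler_piMl// normrM normfV (gtr0_norm x0).
by rewrite ler_pdivrMr// mul1r coord_le_enorm.
Qed.

Lemma radial_field_far (R : realType) n (g : R -> R) (l : R) (x_ : nat -> 'rV[R]_n)
    (y : 'rV[R]_n) i :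
  g r @[r --> +oo] --> l -> (forall k, k.+1%:R <= enorm (x_ k)) ->
  radial_field g (x_ k + y) ord0 i - l * (x_ k ord0 i / enorm (x_ k)) @[k --> \oo] --> 0.
Proof.
move=> gl x_k; pose S := \sum_j `|y ord0 j|.
have S0 : 0 <= S by rewrite sumr_ge0.
have xy_lb k : k.+1%:R - S <= enorm (x_ k + y).
  have : `|enorm (x_ k) - enorm (x_ k + y)| <= S.
    rewrite (le_trans (enorm_lipschitz _ _))// le_eqVlt; apply/orP; left; apply/eqP.
    by apply: eq_bigr => j _; rewrite mxE opprD addNKr normrN.
  by have := x_k k; rewrite ler_norml => ? /andP[]; lra.
apply/cvgrPdist_le => e e0.
have [K [_ hK]] : \forall r \near +oo, `|l - g r| <= e / 2.
  by apply: cvgr_dist_le gl _ _; lra.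
have C0 : 0 <= `|l| * (2 * S) by rewrite !mulr_ge0.
near=> k; set r := enorm (x_ k + y).
(* The shift by [y] costs at most [S]; what remains makes [r] positive, larger than [K], and large
   enough for a direction error of at most [e / 2]. *)
have rk : `|K| + S + 1 + `|l| * (2 * S) / (e / 2) < k.+1%:R.
  apply: (@lt_le_trans _ _ k%:R); last by rewrite ler_nat.
  near: k; exact: nbhs_infty_gtr.
have q0 : 0 <= `|l| * (2 * S) / (e / 2) by rewrite divr_ge0//; lra.
have K0 := normr_ge0 K.
have rK : K < r by have := xy_lb k; have := ler_norm K; rewrite -/r; lra.
have r0 : 0 < r by have := xy_lb k; rewrite -/r; lra.
have rC : `|l| * (2 * S) / (e / 2) <= r by have := xy_lb k; rewrite -/r; lra.
have rE : `|l| * (2 * S / r) <= e / 2.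
  rewrite mulrA ler_pdivrMr// [leRHS]mulrC -ler_pdivrMr//; lra.
have xk0 : 0 < enorm (x_ k) by apply: lt_le_trans (x_k k).
rewrite sub0r normrN radial_fieldE -/r.
(* The error splits into that of the magnitude [g r] and that of the direction. *)
have -> : g r / r * (x_ k + y) ord0 i - l * (x_ k ord0 i / enorm (x_ k)) =
    (g r - l) * ((x_ k + y) ord0 i / r) +
    l * ((x_ k + y) ord0 i / r - x_ k ord0 i / enorm (x_ k)).
  by field; rewrite !gt_eqF.
rewrite (splitr e) (le_trans (ler_normD _ _))//; apply: lerD; rewrite normrM.
  apply: (@le_trans _ _ `|g r - l|); last by rewrite distrC hK.
  rewrite ler_piMr// normrM normfV (gtr0_norm r0) ler_pdivrMr// mul1r.
  exact: coord_le_enorm.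
by rewrite (le_trans _ rE)// ler_wpM2l// unit_vector_dist.
Unshelve. all: by end_near. Qed.

(** * Integrals against the signed measure *)

Section Potential.
Variables (R : realType) (n : nat) (mu : {charge set (borelRn R n) -> \bar R}).
Local Notation T := (borelRn R n).

Lemma charge_integral_cvg (f_ : nat -> T -> R) (f : T -> R) B :
  (forall k, measurable_fun setT (f_ k)) -> (forall k y, `|f_ k y| <= B) ->
  (forall y, f_ k y @[k --> \oo] --> f y) ->
  charge_integral mu (f_ k) @[k --> \oo] --> charge_integral mu f.
Proof.
by move=> mf_ f_B f_f; apply: cvgB; apply: Rintegral_bounded_cvg f_f.
Qed.

Lemma charge_integralB_cst (f : T -> R) c B :
  measurable_fun setT f -> (forall y, `|f y| <= B) ->
  charge_integral mu (fun y => f y - c) = charge_integral mu f - c * fine (mu setT).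
Proof.
move=> mf fB; rewrite /charge_integral.
have E (nu : {finite_measure set T -> \bar R}) :
    Rintegral nu setT (fun y => f y - c) = Rintegral nu setT f - c * fine (nu setT).
  rewrite RintegralB ?Rintegral_cst//; first exact: bounded_integrable mf fB.
  exact: finite_measure_integrable_cst.
rewrite !E.
have -> : fine (mu setT) = fine (pos_variation mu setT) - fine (neg_variation mu setT).
  rewrite (jordan_decomp (hahn_pos_neg mu) measurableT) /cadd /= cscaleN1.
  by rewrite fineB ?fin_num_measure.
ring.
Qed.

End Potential.

(** * Continuity of the potential field and its behaviour at infinity *)

Section PotentialField.
Variables (R : realType) (n : nat) (mu : {charge set (borelRn R n) -> \bar R}).
Variables (g : R -> R) (l : R).
Hypothesis g_cont : {within `[0, +oo[, continuous g}.
Hypothesis g0 : g 0 = 0.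
Hypothesis g_lim : g r @[r --> +oo] --> l.
Hypothesis n_gt0 : (0 < n)%N.
Hypothesis l_gt0 : 0 < l.
Hypothesis mu_gt0 : 0 < fine (mu setT).
Local Notation T := (borelRn R n).
Local Notation V := (potential_field g mu).

Lemma radial_field_shift_measurable (x : 'rV[R]_n) i :
  measurable_fun [set: T] (fun y : T => radial_field g (x + (y : 'rV[R]_n)) ord0 i).
Proof.
apply: (@continuous_borel _ _ (fun y : 'rV[R]_n => radial_field g (x + y) ord0 i)) => y.
apply: (@continuous_comp _ _ _ (fun y : 'rV[R]_n => x + y)
  (fun z => radial_field g z ord0 i)).
  exact: (cvgD (cvg_cst _) cvg_id).
exact: radial_field_continuous.
Qed.

Lemma radial_field_bounded :
  exists2 B, 0 < B & forall y i, `|@radial_field R n g y ord0 i| <= B.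
Proof.
have [B B0 gB] := half_line_bounded g_cont g_lim; exists B => // y i.
by rewrite (le_trans (radial_field_le _ _ _))// gB// enorm_ge0.
Qed.

Lemma potential_field_continuous i : continuous (fun x => V x ord0 i).
Proof.
have [B _ vB] := radial_field_bounded.
rewrite (_ : (fun x => _) = fun x => charge_integral mu
    (fun y : T => radial_field g (x + (y : 'rV[R]_n)) ord0 i)); last first.
  by apply/funext => x; rewrite mxE.
apply: sequential_continuity => x u ux.
apply: (@charge_integral_cvg _ _ mu _ _ B) => [k|k y|y].
- exact: radial_field_shift_measurable.
- exact: vB.
- have uxy : u k + (y : 'rV[R]_n) @[k --> \oo] --> x + (y : 'rV[R]_n).
    exact: (cvgD ux (cvg_cst _)).
  exact: (cvg_comp _ _ uxy (@radial_field_continuous R n g g_cont g0 i _)).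
Qed.

Lemma potential_field_far (x_ : nat -> 'rV[R]_n) i :
  (forall k, k.+1%:R <= enorm (x_ k)) ->
  V (x_ k) ord0 i - l * fine (mu setT) * (x_ k ord0 i / enorm (x_ k))
    @[k --> \oo] --> 0.
Proof.
move=> x_k; have [B B0 vB] := radial_field_bounded.
have xk1 k : `|x_ k ord0 i / enorm (x_ k)| <= 1.
  have xk0 : 0 < enorm (x_ k) by apply: lt_le_trans (x_k k).
  by rewrite normrM normfV (gtr0_norm xk0) ler_pdivrMr// mul1r coord_le_enorm.
pose c k := l * (x_ k ord0 i / enorm (x_ k)).
pose f_ k (y : T) := radial_field g (x_ k + (y : 'rV[R]_n)) ord0 i - c k.
(* Under the integral the subtracted term becomes the constant [c k]; the integrands are bounded by
   [B + l] and tend to 0 pointwise. *)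
have -> : (fun k => V (x_ k) ord0 i - l * fine (mu setT) * (x_ k ord0 i / enorm (x_ k))) =
    fun k => charge_integral mu (f_ k).
  apply/funext => k; rewrite /f_ (@charge_integralB_cst _ _ _ _ _ B).
  - by rewrite mxE /c; ring.
  - exact: radial_field_shift_measurable.
  - by move=> y; exact: vB.
have -> : 0 = charge_integral mu (cst 0 : T -> R).
  by rewrite /charge_integral !Rintegral_cst// !mul0r subrr.
apply: (@charge_integral_cvg _ _ mu _ _ (B + l)) => [k|k y|y].
- by apply: measurable_funB => //; exact: radial_field_shift_measurable.
- rewrite (le_trans (ler_normB _ _))// lerD// normrM (gtr0_norm l_gt0).
  by rewrite ler_piMr// ltW.
- exact: radial_field_far.
Qed.

(** If every cube failed, there would be bad points [x_ k] on the cubes of half-side [k + 1]. On a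
    face [|x_i| = k + 1] one has [|x_i| / |x| >= 1 / n], so the leading term [c x_i / |x|] outweighs
    any error below [c / n]. *)
Lemma potential_field_outward : exists2 r, 0 < r & forall (x : 'rV[R]_n) i,
  (forall j, `|x ord0 j| <= r) -> `|x ord0 i| = r -> 0 < V x ord0 i * x ord0 i.
Proof.
apply: contrapT => nh.
have /choice[x_ x_P] (k : nat) : exists x : 'rV[R]_n, exists i,
    [/\ forall j, `|x ord0 j| <= k.+1%:R, `|x ord0 i| = k.+1%:R &
        V x ord0 i * x ord0 i <= 0].
  apply: contrapT => hk; apply: nh; exists k.+1%:R => // x i xk xi.
  by rewrite ltNge; apply/negP => Vx; apply: hk; exists x, i.
have x_k k : k.+1%:R <= enorm (x_ k).
  by have [i [_ <- _]] := x_P k; exact: coord_le_enorm.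
have x_n k : enorm (x_ k) <= n%:R * k.+1%:R.
  have := enorm_lipschitz (x_ k) 0; rewrite enorm0 subr0 => /(le_trans (ler_norm _)).
  move/le_trans; apply; have [i [hk _ _]] := x_P k.
  rewrite -[X in X%:R * _](card_ord n) mulr_natl -sumr_const.
  by apply: ler_sum => j _; rewrite mxE subr0.
pose c := l * fine (mu setT).
have c0 : 0 < c by rewrite mulr_gt0.
have nR : 0 < n%:R :> R by rewrite ltr0n.
have far (i : 'I_n) : \forall k \near \oo,
    `|V (x_ k) ord0 i - c * (x_ k ord0 i / enorm (x_ k))| < c / n%:R.
  have := @potential_field_far x_ i x_k => /cvgr_distC_lt/(_ (c / n%:R)).
  by rewrite divr_gt0// => /(_ isT); apply: filterS => k; rewrite subr0.
(* The face containing [x_ k] varies with [k], so one rank must serve all the coordinates. *)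
have [k0 _ /(_ _ (leqnn k0)) /= hk] := filter_forall _ far.
have [i [xk xi Vx]] := x_P k0.
have a0 : 0 < `|x_ k0 ord0 i| by rewrite xi.
move: (hk i) (x_n k0) (x_k k0) Vx; rewrite -xi.
move: (enorm _) (x_ k0 ord0 i) (V _ _ _) a0 => e a v a0 va ean ae Va.
have e0 : 0 < e by exact: lt_le_trans ae.
have h1 : c / n%:R * `|a| <= c * (a / e) * a.
  have -> : c * (a / e) * a = c * (`|a| / e) * `|a|.
    have aa : `|a| * `|a| = a * a by rewrite -!expr2 real_normK ?num_real.
    by transitivity (c / e * (a * a)); [ring|rewrite -aa; ring].
  rewrite ler_wpM2r// (ler_wpM2l (ltW c0))//.
  by rewrite ler_pdivlMr// mulrC ler_pdivrMr// mulrC.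
have : `|(v - c * (a / e)) * a| < c / n%:R * `|a| by rewrite normrM ltr_pM2r.
by rewrite ltr_norml => /andP[]; rewrite mulrBl; lra.
Qed.

End PotentialField.

Theorem theorem5 (R : realType) (n : nat) (hn : (1 <= n)%N)
    (g : R -> R) (hg : {within `[0, +oo[, continuous g}) (hg0 : g 0 = 0)
    (mu : {charge set (borelRn R n) -> \bar R})
    (hmu_pos : (0 < mu setT)%E)
    (hmu_le : (mu setT <= tot_variation mu setT)%E)
    (hmu_fin : (tot_variation mu setT < +oo)%E)
    (ginf : R) (hginf : g r @[r --> +oo] --> ginf) (hginf_pos : 0 < ginf) :
  exists xc : 'rV[R]_n, potential_field g mu xc = 0.
Proof.
have mu_gt0 : 0 < fine (mu setT).
  by rewrite fine_gt0// hmu_pos ltey_eq fin_num_measure.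
have [r r0 hr] := potential_field_outward hg hg0 hginf hn hginf_pos mu_gt0.
set V := potential_field g mu in hr *.
pose F j (x : 'rV[R]_n) := Num.max (- r) (Num.min r (x ord0 j - V x ord0 j)).
have F_cont j : continuous (F j).
  have Vc := @potential_field_continuous _ _ mu _ _ hg hg0 hginf j.
  move=> x; apply: (@continuous_max _ _ (cst (- r))
    (cst r \min (fun x : 'rV[R]_n => x ord0 j - V x ord0 j))); first exact: cst_continuous.
  apply: continuous_min; first exact: cst_continuous.
  exact: (cvgB (@continuous_coord _ _ j x) (Vc x)).
have F_bound j x : `|F j x| <= r.
  by rewrite ler_norml le_max lexx /= ge_max ge_min lexx /= ge0_cp//; lra.
have [x xF] := bounded_fixed_point hn r0 F_cont F_bound.
exists x; apply/rowP => j; rewrite [RHS]mxE; apply/eqP/negPn/negP => Vj.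
have xr i : `|x ord0 i| <= r by rewrite -xF.
have Fj := xF j; have := hr x j xr; move: Fj; rewrite /F.
move: (x ord0 j) (V x ord0 j) (xr j) Vj => a v; rewrite ler_norml => /andP[ra ar] v0.
(* If [v > 0], then [a - v < a], so the fixed coordinate must have been clipped at [a = - r], and
   [v * a < 0] contradicts the sign on that face. For [v < 0] the clipping is at [r]. *)
have [v_gt0|v_lt0] : 0 < v \/ v < 0 by move: v0; rewrite neq_lt => /orP[]; [right|left].
  have -> : Num.min r (a - v) = a - v by apply/min_idPr; lra.
  case: (leP (- r) (a - v)) => [_ ava|_ <-]; first lra.
  by rewrite normrN (gtr0_norm r0) pmulr_rgt0// => /(_ erefl); lra.
case: (leP r (a - v)) => [_|avr].
  have -> : Num.max (- r) r = r by apply/max_idPr; lra.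
  by move=> <-; rewrite (gtr0_norm r0) nmulr_rgt0// => /(_ erefl); lra.
have -> : Num.max (- r) (a - v) = a - v by apply/max_idPr; lra.
lra.
Qed.
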